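(* Let $t_1,\ldots,t_n\in\mathbb T$ be distinct points and let $w_1,\ldots,w_n\in\mathbb T$. For any admissible tuple $\gamma=\{\gamma_1,\ldots,\gamma_{n-1}\}$, the function $$f_{\gamma}(z)=w_n\cdot \frac{1-(1-z\overline{t}_n)\displaystyle\sum_{i=1}^{n-1}\frac{\Delta^{\gamma}_i}{1-z\overline{t}_i}}{1-(1-z\overline{t}_n)\displaystyle\sum_{i=1}^{n-1}\frac{\overline{w}_iw_n\Delta^{\gamma}_i}{1-z\overline{t}_i}},$$ with the numbers $\Delta^\gamma_i$ defined in the context, is a finite Blaschke product of degree $$\deg f_{\gamma}=n-1-\#\{i\in\{1,\ldots,n-1\}:\ \Delta^{\gamma}_i=0\}$$ and satisfies $f_\gamma(t_i)=w_i$ for $i=1,\ldots,n$. Moreover, for $i=1,\ldots,n-1$, $|f_{\gamma}'(t_i)|=\gamma_i$ if and only if $\Delta^{\gamma}_i\neq 0$, and $|f_{\gamma}'(t_i)|<\gamma_i$ otherwise.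
   Context: $\mathbb T$ is the unit circle in $\mathbb C$. A finite Blaschke product of degree $k$ is a function $f(z)=c\prod_{i=1}^k\frac{z-a_i}{1-z\overline{a}_i}$ with $|c|=1$, $|a_i|<1$ (unimodular constants have degree $0$). Given distinct $t_1,\ldots,t_n\in\mathbb T$ and $w_1,\ldots,w_n\in\mathbb T$, a tuple $\gamma=\{\gamma_1,\ldots,\gamma_{n-1}\}$ of positive numbers (ordered) is called admissible if the $(n-1)\times(n-1)$ Hermitian matrix $P^{\gamma}_{n-1}=[p_{ij}]_{i,j=1}^{n-1}$ with $p_{ij}=\frac{1-w_i\overline{w}_j}{1-t_i\overline{t}_j}$ for $i\ne j$ and $p_{ii}=\gamma_i$ is positive definite. Let $\mathbf p_n=(p_{1,n},\ldots,p_{n-1,n})^{\top}$ with $p_{i,n}=\frac{1-w_i\overline{w}_n}{1-t_i\overline{t}_n}$. For an admissible $\gamma$, let $(\Delta^\gamma_1,\ldots,\Delta^\gamma_{n-1})^{\top}=(P_{n-1}^{\gamma})^{-1}\mathbf p_n$; equivalently, by Cramer's rule, $\Delta^{\gamma}_i=\det P_{n-1,i}^{\gamma}(\mathbf p_n)/\det P_{n-1}^{\gamma}$, where $P_{n-1,i}^{\gamma}(\mathbf p_n)$ is obtained from $P_{n-1}^{\gamma}$ by replacing its $i$-th column by $\mathbf p_n$. $f_\gamma$ is regarded as a rational function, so that removable singularities (in particular at the points $t_i$) are removed. *)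

(* Defs.v *)
From HB Require Import structures.
From mathcomp Require Import all_boot all_order all_algebra.
From mathcomp Require Import generic_quotient fraction sesquilinear spectral.

Set Implicit Arguments.
Unset Strict Implicit.
Unset Printing Implicit Defensive.
Import Order.TTheory GRing.Theory Num.Theory.
Local Open Scope ring_scope.
Local Open Scope quotient_scope.
Local Open Scope sesquilinear_scope.

(* Everything is defined over a numClosedFieldType C, so that ^* is complex
   conjugation; the complex numbers are the instance C := R[i], R a realType.
   The order on C is the partial one: 0 < x means that x is a positive real. *)

Definition ratC (C : fieldType) (c : C) : {fraction {poly C}} := tofrac c%:P.

Definition ratX (C : fieldType) : {fraction {poly C}} := tofrac 'X.
Arguments ratX {C}.

(* Value at a of a rational function put in lowest terms, so that removable
   singularities are removed; the value at a pole is the junk value 0. *)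
Definition ratval (C : fieldType) (f : {fraction {poly C}}) (a : C) : C :=
  let p := \n_(repr f) in let q := \d_(repr f) in let g := gcdp p q in
  (p %/ g).[a] / (q %/ g).[a].

Lemma ratval_tofrac (C : fieldType) (p q : {poly C}) (a : C) :
  q.[a] != 0 -> ratval (tofrac p / tofrac q) a = p.[a] / q.[a].
Proof.
move=> qa0; have q0 : q != 0 by apply: contraNneq qa0 => ->; rewrite horner0.
have fE : tofrac p / tofrac q = \pi_({fraction {poly C}}) (Ratio p q).
  have tofracE r : tofrac r = \pi_({fraction {poly C}}) (Ratio r 1).
    by unlock FracField.tofrac.
  rewrite !tofracE; transitivity (FracField.mul
    (\pi_({fraction {poly C}}) (Ratio p 1))
    (FracField.inv (\pi_({fraction {poly C}}) (Ratio q 1)))) => //.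
  rewrite -FracField.pi_inv -FracField.pi_mul /FracField.invf /FracField.mulf.
  by rewrite !numden_Ratio ?oner_neq0 // mulr1 mul1r.
rewrite /ratval fE.
set P := \n_(repr _); set Q := \d_(repr _).
have PQ : P * q = Q * p.
  by have := FracField.equivf_l (Ratio p q); rewrite !numden_Ratio.
have Q0 : Q != 0 by apply: denom_ratioP.
set g := gcdp P Q.
have g0 : g != 0 by rewrite gcdp_eq0 negb_and Q0 orbT.
have Pg : P = P %/ g * g by rewrite divpK ?dvdp_gcdl.
have Qg : Q = Q %/ g * g by rewrite divpK ?dvdp_gcdr.
have E : (P %/ g) * q = (Q %/ g) * p.
  by apply: (mulIf g0); rewrite mulrAC -Pg PQ {1}Qg mulrAC.
have cop : coprimep (Q %/ g) (P %/ g).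
  by rewrite coprimep_sym; apply: coprimep_div_gcd; rewrite Q0 orbT.
have dq : Q %/ g %| q.
  by rewrite -(Gauss_dvdpr _ cop) E dvdp_mulr.
have Qa0 : (Q %/ g).[a] != 0.
  apply: contraNneq qa0 => Z; move/dvdpP: dq => [r ->].
  by rewrite hornerM Z mulr0.
apply/eqP; rewrite eqr_div // -!hornerM E; apply/eqP.
by rewrite mulrC.
Qed.

Definition is_blaschke (C : numClosedFieldType) (k : nat)
    (f : {fraction {poly C}}) : Prop :=
  exists (c : C) (a : 'I_k -> C),
    [/\ `|c| = 1, forall i, `|a i| < 1
      & f = ratC c * \prod_(i < k)
              ((ratX - ratC (a i)) / (1 - ratX * ratC (a i)^*))].

Definition posdefmx (C : numClosedFieldType) (m : nat) (A : 'M[C]_m) : Prop :=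
  A \is hermsymmx /\
  forall x : 'cV[C]_m, x != 0 -> 0 < (x^t* *m A *m x) 0 0.

(* The interpolation nodes and values are indexed by 'I_m.+1, i.e. n = m.+1;
   ord_max is the last index n, and init i embeds the indices 1, ..., n-1. *)
Definition init (m : nat) (i : 'I_m) : 'I_m.+1 := widen_ord (leqnSn m) i.

Section Data.
Variables (C : numClosedFieldType) (m : nat).
Variables (t w : 'I_m.+1 -> C) (gamma : 'I_m -> C).

Definition pick_entry (i j : 'I_m.+1) : C :=
  (1 - w i * (w j)^*) / (1 - t i * (t j)^*).

Definition pick_mx : 'M[C]_m :=
  \matrix_(i, j) (if i == j then gamma i else pick_entry (init i) (init j)).

Definition admissible : Prop := (forall i, 0 < gamma i) /\ posdefmx pick_mx.

Definition pick_col : 'cV[C]_m := \col_i pick_entry (init i) ord_max.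

Definition Delta (i : 'I_m) : C := (invmx pick_mx *m pick_col) i 0.

Definition fgamma : {fraction {poly C}} :=
  let z := ratX in let tn := t ord_max in let wn := w ord_max in
  ratC wn *
  ((1 - (1 - z * ratC tn^*) *
        \sum_(i < m) ratC (Delta i) / (1 - z * ratC (t (init i))^*)) /
   (1 - (1 - z * ratC tn^*) *
        \sum_(i < m) ratC ((w (init i))^* * wn * Delta i) /
                     (1 - z * ratC (t (init i))^*))).

End Data.

(* Main.v *)
Require Import Defs.
From HB Require Import structures.
From mathcomp Require Import all_boot all_order all_algebra.
From mathcomp Require Import complex sesquilinear fraction ring.
From mathcomp Require Import all_classical all_reals all_analysis.
Import Order.TTheory GRing.Theory Num.Theory.
Import numFieldNormedType.Exports.
Local Open Scope classical_set_scope.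
Local Open Scope ring_scope.

Set Implicit Arguments.
Unset Strict Implicit.
Unset Printing Implicit Defensive.

(** Write [T i], [W i] for the first m nodes and values, [tn], [wn] for the last
    ones, [P] for the Pick matrix, [D] for the vector Delta and [S] for the set
    of indices with [D i != 0].  Off the diagonal [P] is defined by, and on the
    diagonal it trivially satisfies, the Stein identity
      P i j * (1 - T i / T j) = 1 - W i / W j.
    Clearing denominators only over [S] turns the function into [wn * A / B],
    where A and B are polynomials of degree at most #|S|.  With the vector
      v_j(z) = D j * (1 - tn / T j) * prod_(l in S, l != j) (1 - z / T l)
    the Stein identity and P D = p_n give the polynomial identity
      (T i - z) * (P v(z))_i = tn * (W i / wn * B(z) - A(z)),     (row_identity)
    and everything follows from it.

    Conjugating P D = p_n and using uniqueness yields
    conj (D i) = (T i / W i) * (wn / tn) * D i  (Delta_conj), which says that A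
    is, up to a unimodular constant, the reflection z^k conj (B (1 / conj z))
    of B, where k = #|S|  (den_poly_reflect).  If B(z) = 0 at a point which is
    not a node in [S], pairing the row identity with v(z) gives
      (1 - |z|^2) * (v(z)^* P v(z)) = - |A(z)|^2.
    By positive definiteness this is impossible for |z| < 1, and for |z| = 1 it
    forces A(z) = 0, hence v(z)^* P v(z) = 0 by the row identity, again
    impossible; when [S] is empty, B = 1.  At a node of [S] only one term of B
    survives, and it is nonzero.  So B has no zero in the closed unit disc
    (den_poly_neq0), and the quotient of the reflection of order k of such a
    polynomial by the polynomial itself is a Blaschke product of degree k
    (blaschke_of_reflection).

    The row identity at z = T i is the interpolation condition at T i, while A
    and B visibly agree at tn.  Dividing the row identity by T i - z gives f'(T i) = (wn / tn) * (P v)_i / B at z = T i.  If i is in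
    [S], then v(T i) is supported at i and the modulus of this number is
    P i i = gamma i.  Otherwise the i-th entry of x = v(T i) / B(T i) vanishes,
    |f'(T i)| = |(P x)_i| = x^* P x by the row identity, and positive
    definiteness gives |(P x)_i|^2 < gamma i * x^* P x  (pick_form_schur),
    whence |f'(T i)| < gamma i. *)

Section Algebra.
Local Open Scope sesquilinear_scope.
Variable C : numClosedFieldType.

(** * Unimodular numbers and polynomials *)

Lemma conjCV (x : C) : (x^-1)^* = (x^*)^-1.
Proof. exact: fmorphV. Qed.

Lemma conj_unimodular (x : C) : `|x| = 1 -> x^* = x^-1.
Proof. by move=> x1; rewrite invC_norm x1 expr1n invr1 mul1r. Qed.

Lemma unimodular_neq0 (x : C) : `|x| = 1 -> x != 0.
Proof. by move=> x1; rewrite -normr_eq0 x1 oner_neq0. Qed.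

Lemma one_sub_div_neq0 (x y : C) : y != 0 -> (1 - x / y != 0) = (x != y).
Proof.
by move=> y0; rewrite subr_eq0 eq_sym -(inj_eq (mulIf y0)) divfK // mul1r.
Qed.

Lemma eq_poly_off0 (p q : {poly C}) :
  (forall z, z != 0 -> p.[z] = q.[z]) -> p = q.
Proof.
move=> pq; apply/eqP; rewrite -subr_eq0; apply/negPn/negP => pq0.
pose s := [seq n.+1%:R : C | n <- iota 0 (size (p - q))].
suff: (size s < size (p - q)%R)%N by rewrite size_map size_iota ltnn.
apply: max_poly_roots => //.
  apply/allP => _ /mapP[n _ ->].
  by rewrite rootE hornerD hornerN pq ?subrr // pnatr_eq0.
by rewrite map_inj_uniq ?iota_uniq // => i j /eqP; rewrite eqr_nat => /eqP[].
Qed.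

Lemma ratCM (x y : C) : ratC (x * y) = ratC x * ratC y.
Proof. by rewrite /ratC !rmorphM. Qed.

Lemma ratCV (x : C) : ratC x^-1 = (ratC x)^-1.
Proof. exact: (fmorphV (@tofrac {poly C} \o polyC)). Qed.

(** * Blaschke products from reflected polynomials *)

(** The zeros of the Blaschke product are the reflections in the unit circle of
    the zeros of B, together with 0, repeated as many times as the degree of B
    falls short of k. *)
Lemma blaschke_of_reflection (A B : {poly C}) (k : nat) (u : C) :
    (size B <= k.+1)%N -> (forall z, `|z| <= 1 -> B.[z] != 0) -> `|u| = 1 ->
    (forall z, z != 0 -> z ^+ k * (B.[(z^*)^-1])^* = u * A.[z]) ->
  is_blaschke k (tofrac A / tofrac B).
Proof.
move=> sizeB B_neq0 u1 refl.
have u0 := unimodular_neq0 u1.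
have B0 : B != 0.
  by apply/eqP => B0; have := B_neq0 0; rewrite B0 horner0 eqxx normr0 ler01 => /(_ isT).
have [s Bs] := closed_field_poly_normal B.
set b := lead_coef B in Bs.
have b0 : b != 0 by rewrite lead_coef_eq0.
have size_s : (size s <= k)%N.
  by move: sizeB; rewrite Bs size_scale // size_prod_XsubC.
have s_gt1 r : r \in s -> 1 < `|r|.
  move=> rs; have : ~~ (`|r| <= 1).
    apply/negP => /B_neq0; rewrite Bs hornerZ horner_prod (big_rem r) //=.
    by rewrite hornerXsubC subrr mul0r mulr0 eqxx.
  by rewrite -real_ltNge ?realE ?normr_ge0 ?ler01.
have s0 r : r \in s -> r != 0.
  by move=> /s_gt1 r1; rewrite -normr_gt0 (lt_trans ltr01).
(* beta is the constant coefficient of B. *)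
pose beta := b * \prod_(r <- s) - r.
have beta0 : beta != 0.
  rewrite mulf_neq0 // prodf_seq_neq0; apply/allP => r rs /=.
  by rewrite oppr_eq0 s0.
(* alpha lists the zeros of the product. *)
pose alpha := nseq (k - size s) 0 ++ [seq (r^*)^-1 | r <- s].
have size_alpha : size alpha = k.
  by rewrite size_cat size_nseq size_map subnK.
have alpha_lt1 x : x \in alpha -> `|x| < 1.
  rewrite mem_cat => /orP[|/mapP[r rs ->]].
    by rewrite mem_nseq => /andP[_ /eqP->]; rewrite normr0 ltr01.
  by rewrite normfV norm_conjC invf_lt1 ?s_gt1 // normr_gt0 s0.
have BE : B = beta%:P * \prod_(x <- alpha) (1 - 'X * (x^*)%:P).
  rewrite big_cat big_nseq /= conjC0 mulr0 subr0.
  rewrite iter_mulr_1 expr1n mul1r big_map /beta rmorphM rmorph_prod -mulrA.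
  rewrite -big_split /= {1}Bs -mul_polyC; congr (_ * _).
  apply: eq_big_seq => r rs /=.
  have -> : ((r^*)^-1)^* = r^-1 by rewrite conjCV conjCK.
  rewrite mulrBr mulr1 mulrCA -polyCM mulNr divff ?s0 //.
  by rewrite !polyCN mulrN opprK mulr1 addrC.
have AE : A = (u^-1 * beta^*)%:P * \prod_(x <- alpha) ('X - x%:P).
  apply: eq_poly_off0 => z z0; apply: (mulfI u0); rewrite -refl // Bs.
  rewrite hornerM hornerC mulrA mulVKf //.
  have key : z ^+ size s * (\prod_(r <- s) ('X - r%:P).[(z^*)^-1])^* =
             (\prod_(r <- s) - r)^* * \prod_(r <- s) ('X - ((r^*)^-1)%:P).[z].
    have -> : z ^+ size s = \prod_(r <- s) z.
      by rewrite big_const_seq count_predT iter_mulr_1.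
    rewrite !rmorph_prod -!big_split /=; apply: eq_big_seq => r rs /=.
    rewrite !hornerXsubC rmorphB rmorphN /= conjCV conjCK.
    by field; rewrite z0 conjC_eq0 s0.
  rewrite -{1}(subnK size_s) exprD big_cat big_nseq /= subr0 iter_mulr_1 big_map.
  rewrite hornerZ hornerM hornerXn !horner_prod /beta !rmorphM /=.
  rewrite mulrACA [_ * b^*]mulrC -mulrA -mulrA key.
  by ring.
have c1 : `|u^-1 * beta^* / beta| = 1.
  by rewrite !normrM !normfV norm_conjC u1 invr1 mul1r divff // normr_eq0.
exists (u^-1 * beta^* / beta), (fun i => nth 0 alpha i); split => // [i|].
  by apply: alpha_lt1; rewrite mem_nth // size_alpha.
have prodE (T : comNzRingType) (F : C -> T) :
    \prod_(i < k) F (nth 0 alpha i) = \prod_(x <- alpha) F x.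
  by rewrite (big_nth 0) size_alpha big_mkord.
rewrite {1}AE {1}BE !(rmorphM (@tofrac _)) !rmorph_prod /=.
rewrite (prodE _ (fun x => (ratX - ratC x) / (1 - ratX * ratC x^*))).
rewrite prodf_div invfM mulrACA.
rewrite ratCM ratCV ratCM; congr (_ * (_ * _^-1)).
- by rewrite -ratCM.
- by apply: eq_bigr => x _; rewrite rmorphB.
- by apply: eq_bigr => x _; rewrite rmorphB rmorphM rmorph1.
Qed.

(** * Pick matrix and the vector Delta *)

Section Data.
Variables (m : nat) (t w : 'I_m.+1 -> C) (gamma : 'I_m -> C).
Hypotheses (ht : forall i, `|t i| = 1) (t_inj : injective t).
Hypotheses (hw : forall i, `|w i| = 1) (hgamma : admissible t w gamma).

(* Nodes and values are split into the first m ones and the last one. *)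
Let P : 'M[C]_m := pick_mx t w gamma.
Let D : 'I_m -> C := Delta t w gamma.
Let T (i : 'I_m) : C := t (init i).
Let W (i : 'I_m) : C := w (init i).
Let tn : C := t ord_max.
Let wn : C := w ord_max.

Let T0 i : T i != 0. Proof. exact/unimodular_neq0/ht. Qed.
Let W0 i : W i != 0. Proof. exact/unimodular_neq0/hw. Qed.
Let tn0 : tn != 0. Proof. exact/unimodular_neq0/ht. Qed.
Let wn0 : wn != 0. Proof. exact/unimodular_neq0/hw. Qed.
Let TC i : (T i)^* = (T i)^-1. Proof. exact/conj_unimodular/ht. Qed.
Let WC i : (W i)^* = (W i)^-1. Proof. exact/conj_unimodular/hw. Qed.
Let tnC : tn^* = tn^-1. Proof. exact/conj_unimodular/ht. Qed.
Let wnC : wn^* = wn^-1. Proof. exact/conj_unimodular/hw. Qed.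

Let init_inj : injective (@init m).
Proof. by move=> i j /(congr1 val) /= ij; apply: val_inj. Qed.

Let T_neq i j : i != j -> T i != T j.
Proof. by move=> ij; rewrite (inj_eq t_inj) (inj_eq init_inj). Qed.

Let T_neq_tn i : T i != tn.
Proof.
by rewrite (inj_eq t_inj) -(inj_eq val_inj) /= neq_ltn ltn_ord.
Qed.

(** On the diagonal both sides vanish, so that the identity holds whatever the
    numbers gamma are. *)
Lemma pick_stein i j : P i j * (1 - T i / T j) = 1 - W i / W j.
Proof.
rewrite mxE; case: eqVneq => [->|ij]; first by rewrite !divff // !subrr mulr0.
rewrite /pick_entry -/(T i) -/(T j) -/(W i) -/(W j) TC WC divfK //.
by rewrite one_sub_div_neq0 ?T_neq.
Qed.

Lemma pick_conj i j : (P i j)^* = W j / T j * (T i / W i) * P i j.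
Proof.
rewrite mxE; case: eqVneq => [->|ij].
  rewrite conj_Creal ?gtr0_real //; last by case: hgamma.
  by field; rewrite T0 W0.
rewrite /pick_entry -/(T i) -/(T j) -/(W i) -/(W j) TC WC.
rewrite rmorphM /= conjCV !rmorphB !rmorphM !rmorph1 /= !conjCV !TC !WC !invrK.
have TT : T i - T j != 0 by rewrite subr_eq0 T_neq.
by field; rewrite -opprB oppr_eq0 TT !T0 W0 !W0.
Qed.

Lemma pick_col_conj i : (pick_entry t w (init i) ord_max)^*
  = wn / tn * (T i / W i) * pick_entry t w (init i) ord_max.
Proof.
rewrite /pick_entry -/(T i) -/(W i) -/wn -/tn tnC wnC.
rewrite rmorphM /= conjCV !rmorphB !rmorphM !rmorph1 /= !conjCV !TC !WC tnC wnC !invrK.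
have TT : T i - tn != 0 by rewrite subr_eq0 T_neq_tn.
by field; rewrite -opprB oppr_eq0 TT !T0 W0 tn0 wn0.
Qed.

Lemma pick_col_stein i :
  pick_entry t w (init i) ord_max * (1 - T i / tn) = 1 - W i / wn.
Proof.
rewrite /pick_entry -/(T i) -/(W i) -/wn -/tn tnC wnC divfK //.
by rewrite one_sub_div_neq0.
Qed.

(** The Hermitian form [x |-> x^* P x], for vectors given as functions. *)
Definition pick_form (x : 'I_m -> C) : C :=
  \sum_i (x i)^* * \sum_j P i j * x j.

Lemma pick_form_gt0 (x : 'I_m -> C) : (exists i, x i != 0) -> 0 < pick_form x.
Proof.
case=> i xi; have [_ [_ /(_ (\col_j x j))]] := hgamma.
suff -> : ((\col_j x j)^t* *m pick_mx t w gamma *m \col_j x j) 0 0 = pick_form x.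
  by apply; apply: contraNneq xi => /matrixP/(_ i 0); rewrite !mxE => ->.
rewrite -mulmxA mxE; apply: eq_bigr => j _; rewrite !mxE; congr (_ * _).
by apply: eq_bigr => l _; rewrite !mxE.
Qed.

Lemma pick_mx_unit : P \in unitmx.
Proof.
rewrite unitmxE unitfE; apply/det0P => -[v v0 vP0].
have [_ [_ /(_ (v^t* ))]] := hgamma.
rewrite trmxCK vP0 mul0mx mxE ltxx => vt_neq0; suff: false by []; apply: vt_neq0.
by apply: contraNneq v0 => vt0; rewrite -[v]trmxCK vt0 trmx0 map_mx0.
Qed.

Lemma Delta_eq i : \sum_j P i j * D j = pick_entry t w (init i) ord_max.
Proof.
transitivity ((P *m (invmx P *m pick_col t w)) i 0).
  by rewrite mxE.
by rewrite mulKVmx ?pick_mx_unit // mxE.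
Qed.

Lemma Delta_uniq (x : 'I_m -> C) :
  (forall i, \sum_j P i j * x j = pick_entry t w (init i) ord_max) ->
  forall i, x i = D i.
Proof.
move=> xE i; rewrite /D /Delta (_ : pick_col t w = P *m \col_j x j).
  by rewrite mulKmx ?pick_mx_unit // mxE.
by apply/colP => j; rewrite !mxE -xE; apply: eq_bigr => l _; rewrite !mxE.
Qed.

(** Conjugating the system [P D = p_n] multiplies its coefficients by unimodular
    numbers, so that the conjugate of [D] solves a rescaling of the same system. *)
Lemma Delta_conj i : (D i)^* = T i / W i * (wn / tn) * D i.
Proof.
suff E : W i / T i * (tn / wn) * (D i)^* = D i.
  by rewrite -{2}E; field; rewrite !(T0, W0, tn0, wn0).
apply: (Delta_uniq (x := fun i => W i / T i * (tn / wn) * (D i)^*)) => {}i.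
transitivity (W i / T i * (tn / wn) * (\sum_j P i j * D j)^*).
  rewrite rmorph_sum mulr_sumr; apply: eq_bigr => j _.
  rewrite rmorphM /= pick_conj. field.
  by rewrite !(T0, W0, tn0, wn0).
rewrite Delta_eq pick_col_conj; field.
by rewrite !(T0, W0, tn0, wn0).
Qed.

(** * Numerator and denominator *)

(** Common denominator of the fractions [D l / (1 - z / T l)]; the indices with
    [D l = 0] are left out, so that the degree is the expected one. *)
Definition node_poly : {poly C} := \prod_(l | D l != 0) (1 - (T l)^-1 *: 'X).

(** The common denominator without its factor of index [j]. *)
Definition cofactor_poly (j : 'I_m) : {poly C} :=
  \prod_(l | (D l != 0) && (l != j)) (1 - (T l)^-1 *: 'X).

(** Numerator and denominator of the interpolant, multiplied by [node_poly];
    the factor [wn] in front is not included. *)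
Definition num_poly : {poly C} :=
  node_poly - (1 - tn^-1 *: 'X) * \sum_j D j *: cofactor_poly j.

Definition den_poly : {poly C} :=
  node_poly - (1 - tn^-1 *: 'X) * \sum_j (wn / W j * D j) *: cofactor_poly j.

(* Pointwise values of the four polynomials above. *)
Let Q z := node_poly.[z].
Let q j z := (cofactor_poly j).[z].
Let A z := num_poly.[z].
Let B z := den_poly.[z].

Lemma horner_linear (c z : C) : (1 - c^-1 *: 'X).[z] = 1 - z / c.
Proof. by rewrite !hornerE mulrC. Qed.

Lemma node_polyE j :
  D j != 0 -> node_poly = (1 - (T j)^-1 *: 'X) * cofactor_poly j.
Proof. by move=> Dj; rewrite /node_poly (bigD1 j). Qed.

(** Multiplication by [D j] makes the factorization valid for all [j]. *)
Lemma node_polyEz j z : D j * Q z = D j * ((1 - z / T j) * q j z).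
Proof.
have [->|Dj] := eqVneq (D j) 0; first by rewrite !mul0r.
by rewrite /Q (node_polyE Dj) hornerM horner_linear.
Qed.

Lemma num_polyEz z : A z = Q z - (1 - z / tn) * \sum_j D j * q j z.
Proof.
rewrite /A !hornerE horner_sum [_ * z]mulrC; congr (_ - _ * _).
by apply: eq_bigr => j _; rewrite hornerZ.
Qed.

Lemma den_polyEz z : B z = Q z - (1 - z / tn) * \sum_j wn / W j * D j * q j z.
Proof.
rewrite /B !hornerE horner_sum [_ * z]mulrC; congr (_ - _ * _).
by apply: eq_bigr => j _; rewrite hornerZ.
Qed.

(** The vector [v(z)], which is [node_poly] times the vector with entries
    [D j * (T j - tn) / (T j - z)]. *)
Definition weight (z : C) (j : 'I_m) : C := D j * (1 - tn / T j) * q j z.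

Lemma row_identity i z :
  (T i - z) * (\sum_j P i j * weight z j) = tn * (W i / wn * B z - A z).
Proof.
(* The identity (T i - z) * (1 - tn / T j)
     = (T i - tn) * (1 - z / T j) + (tn - z) * (1 - T i / T j)
   makes the left-hand side of the Stein identity appear. *)
have term j : (T i - z) * (P i j * weight z j) =
    (T i - tn) * Q z * (P i j * D j)
    + (tn - z) * (D j * q j z) - (tn - z) * (W i / wn) * (wn / W j * D j * q j z).
  transitivity ((T i - tn) * P i j * (D j * Q z)
                + (tn - z) * (D j * q j z) * (P i j * (1 - T i / T j))).
    by rewrite node_polyEz /weight; ring.
  by rewrite pick_stein; field; rewrite !(T0, W0, wn0).
rewrite mulr_sumr (eq_bigr _ (fun j _ => term j)) sumrB big_split -!mulr_sumr.
rewrite Delta_eq num_polyEz den_polyEz /=.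
have -> : (T i - tn) * Q z * pick_entry t w (init i) ord_max
    = - tn * Q z * (pick_entry t w (init i) ord_max * (1 - T i / tn)).
  by field; rewrite tn0.
by rewrite pick_col_stein; field; rewrite !(W0, wn0, tn0).
Qed.

Lemma cofactor_poly_node j l : D l != 0 -> l != j -> q j (T l) = 0.
Proof.
move=> Dl lj; rewrite /q /cofactor_poly (bigD1 l) ?Dl //= hornerM horner_linear.
by rewrite divff // subrr mul0r.
Qed.

Lemma cofactor_poly_node_neq0 j : q j (T j) != 0.
Proof.
rewrite /q horner_prod; apply/prodf_neq0 => l /andP[_ lj].
by rewrite horner_linear one_sub_div_neq0 // eq_sym T_neq.
Qed.

Lemma den_poly_node j : D j != 0 ->
  B (T j) = - (1 - T j / tn) * (wn / W j * D j * q j (T j)).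
Proof.
move=> Dj; rewrite den_polyEz /Q (node_polyE Dj) hornerM horner_linear.
rewrite divff // subrr mul0r sub0r mulNr (bigD1 j) //= big1 ?addr0 // => l lj.
have [->|Dl] := eqVneq (D l) 0; first by rewrite mulr0 mul0r.
by rewrite cofactor_poly_node ?mulr0 // eq_sym.
Qed.

Lemma den_poly_node_neq0 j : D j != 0 -> B (T j) != 0.
Proof.
move=> Dj; rewrite den_poly_node // mulf_neq0 //.
  by rewrite oppr_eq0 one_sub_div_neq0.
by rewrite !mulf_neq0 ?invr_eq0 // cofactor_poly_node_neq0.
Qed.

(** * The denominator has no zero in the closed unit disc *)

(** [A z] being the numerator, this is the value at a zero of the denominator of
    the identity [(1 - |z|^2) * (v^* P v) = |B|^2 - |A|^2]. *)
Lemma den_poly_root_form z : B z = 0 -> Q z != 0 ->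
  (1 - z * z^*) * pick_form (weight z) = - (A z * (A z)^*).
Proof.
move=> Bz Qz.
(* Both Q * (v^* P v) and Q * conj A are multiples of the same sum sigma. *)
pose sigma := \sum_j (D j)^* * (q j z)^* * q j z * (tn / T j - 1).
have form_eq : Q z * pick_form (weight z) = - (A z * sigma).
  rewrite /pick_form mulr_sumr /sigma mulr_sumr -sumrN; apply: eq_bigr => j _.
  have [Dj|Dj] := eqVneq (D j) 0.
    by rewrite /weight Dj !(mul0r, conjC0, mulr0, oppr0).
  have := row_identity j z; rewrite Bz mulr0 sub0r => row.
  transitivity ((D j)^* * (q j z)^* * q j z * (1 - T j / tn) / T j *
                ((T j - z) * \sum_l P j l * weight z l)).
    rewrite /Q (node_polyE Dj) hornerM horner_linear -/(q j z).
    rewrite {1}/weight !rmorphM rmorphB rmorph1 rmorphM /= conjCV TC tnC.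
    by field; rewrite !(T0, tn0).
  by rewrite row; field; rewrite !(T0, tn0).
have Q_eq : Q z = (1 - z / tn) * \sum_j tn / T j * (D j)^* * q j z.
  move: Bz; rewrite den_polyEz => /eqP; rewrite subr_eq0 => /eqP ->; congr (_ * _).
  apply: eq_bigr => j _; rewrite Delta_conj; field.
  by rewrite !(T0, W0, tn0, wn0).
have A_eq : Q z * (A z)^* = (1 - z * z^*) * sigma.
  rewrite num_polyEz rmorphB rmorphM rmorph_sum rmorphB rmorph1 rmorphM /=.
  rewrite conjCV tnC invrK mulrBr {1}Q_eq -mulrA mulr_suml mulr_sumr [Q z * _]mulrA.
  rewrite mulr_sumr -sumrB /sigma mulr_sumr; apply: eq_bigr => j _.
  have conj_node : (D j)^* * (Q z)^* = (D j)^* * ((1 - z^* * T j) * (q j z)^*).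
    by rewrite -rmorphM /= node_polyEz !rmorphM rmorphB rmorph1 rmorphM /= conjCV TC invrK.
  have node : (D j)^* * Q z = (D j)^* * ((1 - z / T j) * q j z).
    rewrite Delta_conj -!mulrA; do 4!congr (_ * _); exact: node_polyEz.
  rewrite rmorphM /=.
  transitivity ((1 - z / tn) * (tn / T j) * q j z * ((D j)^* * (Q z)^*)
    - (1 - z^* * tn) * (q j z)^* * ((D j)^* * Q z)); first by ring.
  by rewrite conj_node node; field; rewrite !(T0, tn0).
apply: (mulfI Qz); rewrite mulrCA form_eq !mulrN; congr (- _).
by rewrite [RHS]mulrCA A_eq mulrCA.
Qed.

Lemma den_poly_neq0 z : `|z| <= 1 -> B z != 0.
Proof.
move=> z1; apply/negP => /eqP Bz.
have Qz : Q z != 0.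
  apply/negP; rewrite /Q horner_prod => /prodf_eq0[j Dj].
  rewrite horner_linear -[_ == 0]negbK one_sub_div_neq0 // negbK => /eqP zT.
  by have := den_poly_node_neq0 Dj; rewrite -zT Bz eqxx.
have [j Dj] : exists j, D j != 0.
  apply/existsP; apply: contra_eqT Bz => /existsPn D0.
  rewrite den_polyEz big1 ?mulr0 ?subr0 // => j _.
  by have := D0 j; rewrite negbK => /eqP->; rewrite mulr0 mul0r.
have form_gt0 : 0 < pick_form (weight z).
  apply: pick_form_gt0; exists j; rewrite /weight !mulf_neq0 //.
    by rewrite one_sub_div_neq0 // eq_sym T_neq_tn.
  apply: contraNneq Qz => qz.
  by rewrite /Q (node_polyE Dj) hornerM -/(q j z) qz mulr0.
have := den_poly_root_form Bz Qz; rewrite -!normCK => form_eq.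
have zz1 : 0 <= 1 - `|z| ^+ 2 by rewrite subr_ge0 expr_le1.
(* The two sides of form_eq have opposite signs. *)
have Az : A z = 0.
  apply/eqP; rewrite -normr_eq0 -sqrf_eq0 -oppr_eq0 eq_le -{2}form_eq.
  by rewrite oppr_le0 exprn_ge0 ?normr_ge0 //= mulr_ge0 // ltW.
have : Q z * pick_form (weight z) = 0.
  rewrite /pick_form mulr_sumr big1 // => i _.
  have [Di|Di] := eqVneq (D i) 0.
    by rewrite /weight Di !mul0r conjC0 mul0r mulr0.
  have := row_identity i z; rewrite Bz Az mulr0 subr0 mulr0 => /eqP.
  rewrite mulf_eq0 => /orP[|/eqP->]; last by rewrite !mulr0.
  rewrite subr_eq0 => /eqP Tz; case/eqP: Qz.
  by rewrite /Q (node_polyE Di) hornerM horner_linear -Tz divff // subrr mul0r.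
by move/eqP; rewrite mulf_eq0 (negPf Qz) gt_eqF.
Qed.

(** * Reflection, degree and interpolation *)

(** The number of nonzero entries of Delta. *)
Definition support_size : nat := #|[pred j | D j != 0]|.

Let k := support_size.
Let u := \prod_(l | D l != 0) - T l.

Lemma node_poly_reflect z : z != 0 -> z ^+ k * (Q (z^*)^-1)^* = u * Q z.
Proof.
move=> z0; rewrite /Q /node_poly !horner_prod /k /support_size -prodr_const.
rewrite rmorph_prod -!big_split /=; apply: eq_bigr => l _.
rewrite !horner_linear rmorphB rmorph1 rmorphM /= !conjCV conjCK TC invrK.
by field; rewrite z0 T0.
Qed.

Lemma cofactor_poly_reflect j z : D j != 0 -> z != 0 ->
  z ^+ k * (q j (z^*)^-1)^* = - (z / T j) * (u * q j z).
Proof.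
move=> Dj z0; rewrite /q /cofactor_poly !horner_prod /k /support_size -prodr_const.
rewrite /u (bigD1 j) //= [\prod_(l | D l != 0) - T l](bigD1 j) //=.
rewrite rmorph_prod -!mulrA -!big_split /= mulrA.
congr (_ * _); first by field; rewrite T0.
apply: eq_bigr => l _.
rewrite !horner_linear rmorphB rmorph1 rmorphM /= !conjCV conjCK TC invrK.
by field; rewrite z0 T0.
Qed.

(** [z ^+ k] is the power that turns the conjugate of [node_poly] at
    [1 / conj z] into a polynomial in [z]. *)
Lemma den_poly_reflect z : z != 0 -> z ^+ k * (B (z^*)^-1)^* = u * A z.
Proof.
move=> z0; rewrite den_polyEz num_polyEz rmorphB mulrBr node_poly_reflect //.
rewrite mulrBr; congr (_ - _); rewrite rmorphM rmorph_sum mulrCA [RHS]mulrCA.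
rewrite !mulr_sumr; apply: eq_bigr => j _.
have [->|Dj] := eqVneq (D j) 0; first by rewrite !(mulr0, mul0r, rmorph0).
rewrite rmorphM /= [z ^+ k * _]mulrCA cofactor_poly_reflect // !rmorphM /=.
rewrite Delta_conj rmorphB rmorph1 rmorphM /= !conjCV conjCK wnC WC tnC !invrK.
by field; rewrite !(T0, W0, tn0, wn0, z0).
Qed.

Lemma size_linear (c : C) : c != 0 -> size (1 - c^-1 *: 'X) = 2.
Proof.
move=> c0; rewrite addrC size_addl ?size_opp ?size_scale ?invr_eq0 ?size_polyX //.
by rewrite size_poly1.
Qed.

Lemma size_node_poly : size node_poly = k.+1.
Proof.
rewrite /node_poly size_prod => [|l _]; last by rewrite -size_poly_gt0 size_linear.
rewrite (eq_bigr (fun=> 2)) => [|l _]; last by rewrite size_linear.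
by rewrite sum_nat_const muln2 -addnn -addnS addKn.
Qed.

Lemma size_den_poly : (size den_poly <= k.+1)%N.
Proof.
rewrite (leq_trans (size_polyD _ _)) // geq_max size_node_poly leqnn size_opp /=.
rewrite mulr_sumr (leq_trans (size_sum _ _ _)) //; apply/bigmax_leqP => j _.
have [->|Dj] := eqVneq (D j) 0; first by rewrite mulr0 scale0r mulr0 size_poly0.
rewrite -scalerAr (leq_trans (size_scale_leq _ _)) //.
rewrite -size_node_poly (node_polyE Dj).
have c0 : cofactor_poly j != 0.
  by apply/eqP => c0; have := size_node_poly; rewrite (node_polyE Dj) c0 mulr0 size_poly0.
by rewrite !size_mul ?size_linear // -size_poly_gt0 size_linear.
Qed.

Lemma den_poly_ord_max : B tn = Q tn /\ A tn = Q tn.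
Proof. by rewrite den_polyEz num_polyEz divff // subrr !mul0r subr0. Qed.

Lemma num_poly_at_node i : wn * A (t i) = w i * B (t i).
Proof.
have [->|ni] := eqVneq i ord_max.
  by have [B_tn A_tn] := den_poly_ord_max; rewrite B_tn A_tn.
have lt_i : (i < m)%N by rewrite ltn_neqAle -ltnS ltn_ord andbT.
have -> : i = init (Ordinal lt_i) by apply: val_inj.
have /esym/eqP := row_identity (Ordinal lt_i) (T (Ordinal lt_i)).
rewrite subrr mul0r mulf_eq0 (negPf tn0) subr_eq0 => /eqP <-.
by rewrite mulrCA mulrA divfK.
Qed.

Lemma fgamma_frac : fgamma t w gamma = tofrac (wn *: num_poly) / tofrac den_poly.
Proof.
have frac_linear (c : C) : 1 - ratX * ratC c^-1 = tofrac (1 - c^-1 *: 'X).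
  by rewrite rmorphB rmorph1 -mul_polyC rmorphM mulrC.
have nodeF0 : tofrac node_poly != 0.
  by rewrite tofrac_eq0 -size_poly_gt0 size_node_poly.
have linF0 (c : C) : c != 0 -> tofrac (1 - c^-1 *: 'X) != 0.
  by move=> c0; rewrite tofrac_eq0 -size_poly_gt0 size_linear.
(* The fractions with F i = 0 contribute nothing, although node_poly lacks their
   denominators. *)
have sumE (F : 'I_m -> C) : (forall i, D i = 0 -> F i = 0) ->
    1 - (1 - ratX * ratC tn^*) * (\sum_i ratC (F i) / (1 - ratX * ratC (T i)^*))
  = tofrac (node_poly - (1 - tn^-1 *: 'X) * \sum_j F j *: cofactor_poly j)
    / tofrac node_poly.
  move=> F0; apply: (mulIf nodeF0); rewrite divfK // mulrBl mul1r.
  rewrite rmorphB rmorphM tnC frac_linear rmorph_sum -mulrA mulr_suml /=.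
  congr (_ - _ * _); apply: eq_bigr => i _.
  rewrite -mul_polyC rmorphM TC frac_linear.
  have [Di|Di] := eqVneq (D i) 0.
    by rewrite F0 // /ratC !rmorph0 !mul0r.
  by rewrite (node_polyE Di) rmorphM mulrA divfK ?linF0.
rewrite /fgamma sumE // sumE; last by move=> i Di; rewrite -/(D i) Di mulr0.
rewrite invfM invrK mulrACA [_^-1 * _]mulrC divff // mulr1 mulrA.
rewrite -[wn *: _]mul_polyC rmorphM; congr (_ * (tofrac (_ - _ * _))^-1).
by apply: eq_bigr => i _; rewrite -/(W i) -/(D i) -/wn WC [_ * wn]mulrC.
Qed.

Lemma support_sizeE : k = (m - #|[set i : 'I_m | D i == 0%R]%SET|)%N.
Proof.
pose a := [pred j | D j == 0].
have card_m : (#|a| + #|[predC a]| = m)%N by rewrite cardC card_ord.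
have kE : k = #|[predC a]| by apply: eq_card => i; rewrite !inE.
transitivity (m - #|a|)%N; first by rewrite kE -(addKn #|a| #|[predC a]|) card_m.
by congr (m - _)%N; apply: eq_card => i; rewrite !inE.
Qed.

Lemma fgamma_blaschke : is_blaschke k (fgamma t w gamma).
Proof.
rewrite fgamma_frac; apply: (@blaschke_of_reflection _ _ _ (u / wn)).
- exact: size_den_poly.
- exact: den_poly_neq0.
- rewrite normrM normfV hw invr1 mulr1 normr_prod big1 // => l _.
  by rewrite normrN ht.
- by move=> z z0; rewrite den_poly_reflect // hornerZ mulrA divfK.
Qed.

Lemma ratval_fgamma z : B z != 0 -> ratval (fgamma t w gamma) z = wn * A z / B z.
Proof. by move=> Bz; rewrite fgamma_frac ratval_tofrac // hornerZ. Qed.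

Lemma ratval_fgamma_node i : ratval (fgamma t w gamma) (t i) = w i.
Proof.
have B0 : B (t i) != 0 by rewrite den_poly_neq0 // ht.
by rewrite ratval_fgamma // num_poly_at_node mulfK.
Qed.

(** * Slopes at the nodes *)

(** Numerator of the difference quotient of the interpolant at [T i], its
    denominator being [den_poly]. *)
Definition slope_poly (i : 'I_m) : {poly C} :=
  (wn / tn) *: \sum_j (P i j * (D j * (1 - tn / T j))) *: cofactor_poly j.

Lemma slope_polyE i z :
  (slope_poly i).[z] = wn / tn * \sum_j P i j * weight z j.
Proof.
rewrite hornerZ horner_sum; congr (_ * _); apply: eq_bigr => j _.
by rewrite hornerZ /weight !mulrA.
Qed.

Lemma ratval_fgamma_slope i z : B z != 0 ->
  ratval (fgamma t w gamma) z =
  ratval (fgamma t w gamma) (T i) + (z - T i) * ((slope_poly i).[z] / B z).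
Proof.
move=> Bz; rewrite ratval_fgamma_node ratval_fgamma // -/(W i) slope_polyE.
apply: (mulIf Bz); rewrite mulrDl divfK // -!mulrA mulVf // mulr1.
transitivity (W i * B z - wn / tn * ((T i - z) * (\sum_j P i j * weight z j))).
  by rewrite row_identity; field; rewrite tn0 wn0.
by ring.
Qed.

Lemma slope_node i : D i != 0 -> `|(slope_poly i).[T i] / B (T i)| = gamma i.
Proof.
move=> Di; have gi : 0 < gamma i by case: hgamma.
have B0 : B (T i) != 0 by apply: den_poly_node_neq0.
rewrite slope_polyE (bigD1 i) //= big1 ?addr0 => [|j ji]; last first.
  by rewrite /weight -/(q j _) (cofactor_poly_node Di) 1?eq_sym // !mulr0.
have -> : wn / tn * (P i i * weight (T i) i) = W i / T i * gamma i * B (T i).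
  rewrite mxE eqxx den_poly_node // /weight -/(q i _).
  by field; rewrite !(T0, W0, tn0).
by rewrite mulfK // !normrM normfV hw ht invr1 !mul1r gtr0_norm.
Qed.

(** Strict Cauchy-Schwarz inequality between [x] and the i-th basis vector. *)
Lemma pick_form_schur i (x : 'I_m -> C) : x i = 0 -> (exists j, x j != 0) ->
  `|\sum_j P i j * x j| ^+ 2 < gamma i * pick_form x.
Proof.
move=> xi [j xj]; have [/(_ i) gi [herm _]] := hgamma.
pose g := \sum_j P i j * x j; pose lam := g / gamma i.
(* y = x - lam e_i, the choice of lam making the i-th entry of P y vanish. *)
pose y l := if l == i then - lam else x l.
have ji : j != i by apply: contraNneq xj => ->; rewrite xi.
have Py a : \sum_b P a b * y b = \sum_b P a b * x b - lam * P a i.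
  rewrite (bigD1 i) //= [in RHS](bigD1 i) //= xi mulr0 add0r /y eqxx.
  rewrite mulrN addrC [lam * _]mulrC; congr (_ - _).
  by apply: eq_bigr => b /negPf ->.
have Pii : P i i = gamma i by rewrite mxE eqxx.
have PC a : P a i = (P i a)^*.
  move/is_hermitianmxP: herm => /matrixP/(_ a i).
  rewrite expr0 scale1r [RHS]mxE [X in _ = _ X]mxE. exact.
have yform : pick_form y = pick_form x - lam * g^*.
  rewrite /pick_form (bigD1 i) //= Py -/g Pii divfK ?gt_eqF // subrr mulr0 add0r.
  rewrite [in RHS](bigD1 i) //= xi conjC0 mul0r add0r.
  rewrite rmorph_sum [in X in _ - X](bigD1 i) //= xi mulr0 conjC0 add0r.
  rewrite mulr_sumr -sumrB; apply: eq_bigr => a ai.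
  by rewrite Py /y (negPf ai) PC rmorphM /=; ring.
have : 0 < pick_form y.
  by apply: pick_form_gt0; exists j; rewrite /y (negPf ji).
by rewrite yform subr_gt0 /lam mulrAC -normCK ltr_pdivrMr // mulrC.
Qed.

Lemma slope_node0 i : D i = 0 -> `|(slope_poly i).[T i] / B (T i)| < gamma i.
Proof.
move=> Di; have gi : 0 < gamma i by case: hgamma.
have B0 : B (T i) != 0 by rewrite den_poly_neq0 // ht.
pose x j := weight (T i) j / B (T i).
pose g := \sum_j P i j * x j.
have xi : x i = 0 by rewrite /x /weight Di !mul0r.
have slopeE : (slope_poly i).[T i] / B (T i) = wn / tn * g.
  rewrite slope_polyE -[LHS]mulrA mulr_suml; congr (_ * _).
  by apply: eq_bigr => j _; rewrite -mulrA.
(* The row identity gives (P x)_j for j != i, and it is proportional to the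
   conjugate of P i j with a factor that does not depend on j; x i = 0. *)
have formE : pick_form x = tn / wn * (W i / T i) * g^*.
  rewrite /pick_form /g rmorph_sum mulr_sumr; apply: eq_bigr => j _.
  have [->|ji] := eqVneq j i; first by rewrite xi mulr0 /= !conjC0 mulr0 mul0r.
  have Tji : T j - T i != 0 by rewrite subr_eq0 T_neq.
  have -> : \sum_l P j l * x l = tn / wn * (W j - W i) / (T j - T i).
    apply: (mulIf Tji); rewrite divfK // mulrC.
    rewrite (eq_bigr (fun l => P j l * weight (T i) l / B (T i))); last first.
      by move=> l _; rewrite mulrA.
    rewrite -mulr_suml mulrA row_identity.
    have AT : A (T i) = W i / wn * B (T i).
      by apply: (mulfI wn0); rewrite num_poly_at_node -/(T i) -/(W i); field.
    by rewrite AT; field; rewrite B0 wn0.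
  rewrite rmorphM /= pick_conj.
  have -> : P i j = (1 - W i / W j) / (1 - T i / T j).
    by rewrite -pick_stein mulfK // one_sub_div_neq0 // eq_sym -subr_eq0.
  by field; rewrite !(T0, W0, tn0, wn0) Tji.
have g_norm : `|g| = `|pick_form x|.
  by rewrite formE !(normrM, normfV) norm_conjC !(hw, ht) !(divr1, mul1r).
rewrite slopeE !(normrM, normfV) hw ht divr1 mul1r.
case: (boolP [exists j, x j != 0]) => [/existsP x_neq0|/existsPn x0]; last first.
  rewrite /g big1 ?normr0 // => j _.
  by have := x0 j; rewrite negbK => /eqP ->; rewrite mulr0.
have form_gt0 := pick_form_gt0 x_neq0.
have := pick_form_schur xi x_neq0; rewrite -/g g_norm gtr0_norm //.
by rewrite expr2 ltr_pM2r.
Qed.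

End Data.
End Algebra.

(** * Derivatives of rational functions *)

Section Derivative.
Variable C : numClosedFieldType.

Lemma horner_continuous (p : {poly C}) : continuous (horner p : C -> C).
Proof.
elim/poly_ind: p => [|p c IHp] x.
  rewrite (_ : horner 0 = fun=> 0); first exact: cst_continuous.
  by apply/funext => y; rewrite horner0.
rewrite (_ : horner _ = fun y => p.[y] * y + c).
  apply: (@continuousD _ _ _ (fun y => p.[y] * y) (fun=> c)); last exact: cst_continuous.
  by apply: (@continuousM _ _ (horner p) id); [exact: IHp|exact: cvg_id].
by apply/funext => y; rewrite hornerMXaddC.
Qed.

(** The hypothesis on [f] identifies the difference quotient at [a] with the
    rational function [g / b] near [a]. *)
Lemma derive1_slope (f : C -> C) (b g : {poly C}) (a : C) :
  b.[a] != 0 -> (forall z, b.[z] != 0 -> f z = f a + (z - a) * (g.[z] / b.[z])) ->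
  derive1 f a = g.[a] / b.[a].
Proof.
move=> ba0 fE; rewrite /derive1; apply: cvg_lim; first exact: norm_hausdorff.
have shift : (fun h : C => h + a) @ 0^' --> 0 + a.
  by apply: cvg_within_filter; apply: cvgD; [exact: cvg_id|exact: cvg_cst].
rewrite add0r in shift.
have cp (p : {poly C}) : (fun h : C => p.[h + a]) @ 0^' --> p.[a].
  by apply: continuous_cvg shift; apply: horner_continuous.
have lim_q : (fun h : C => g.[h + a] / b.[h + a]) @ 0^' --> g.[a] / b.[a].
  by apply: cvgM; [exact: cp|apply: cvgV => //; exact: cp].
apply: cvg_trans lim_q; apply: near_eq_cvg.
have b_near : \forall h \near (0 : C)^', b.[h + a] != 0.
  exact: cvgr_neq0 (cp b) ba0.
near=> h.
have h0 : h != 0 by near: h; exact: nbhs_dnbhs_neq.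
rewrite fE; last by near: h.
by rewrite addrK [f a + _]addrC addrK /GRing.scale/= mulKf.
Unshelve. all: by end_near.
Qed.
End Derivative.

Theorem theorem3p6 (R : realType) (m : nat) (t w : 'I_m.+1 -> R[i])
    (gamma : 'I_m -> R[i])
    (ht : forall i, `|t i| = 1) (t_inj : injective t)
    (hw : forall i, `|w i| = 1)
    (hgamma : admissible t w gamma) :
  let f := fgamma t w gamma in
  let D := Delta t w gamma in
  [/\ is_blaschke (m - #|[set i : 'I_m | D i == 0]%SET|) f,
      forall i, ratval f (t i) = w i
    & forall i : 'I_m,
        (`| derive1 (ratval f) (t (init i)) | = gamma i <-> D i != 0) /\
        (D i = 0 -> `| derive1 (ratval f) (t (init i)) | < gamma i)].
Proof.
move=> f D; split.
- by rewrite -support_sizeE; apply: fgamma_blaschke.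
- exact: ratval_fgamma_node.
move=> i.
have derivE : derive1 (ratval f) (t (init i)) =
    (slope_poly t w gamma i).[t (init i)] / (den_poly t w gamma).[t (init i)].
  apply: derive1_slope.
    by apply: den_poly_neq0 => //; rewrite ht.
  exact: ratval_fgamma_slope.
rewrite derivE; have small := @slope_node0 _ _ _ _ _ ht t_inj hw hgamma i.
split=> //; split=> [gammaE|]; last exact: slope_node.
by apply/negP => /eqP /small; rewrite gammaE ltxx.
Qed.
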